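(* Let $p$ be a Wolstenholme prime. Then $$\binom{2p-1}{p-1} \equiv 1 - p^3 B_{p^4-p^3-2} - \frac{3}{2}p^5 B_{p^2-p-4} + \frac{3}{10}p^6 B_{p-5} \pmod{p^7}.$$
   Context: A prime $p$ is called a Wolstenholme prime if $\binom{2p-1}{p-1}\equiv 1 \pmod{p^4}$. The Bernoulli numbers $B_k$ are defined by $\sum_{k=0}^{\infty}B_k\frac{x^k}{k!}=\frac{x}{e^x-1}$ (so $B_0=1$, $B_1=-\frac12$, $B_2=\frac16$). Congruences between rational numbers modulo $p^e$ are understood in the ring of rationals with denominator prime to $p$: $a\equiv b \pmod{p^e}$ means that $a-b$, written in reduced form, has numerator divisible by $p^e$ and denominator prime to $p$. *)

(* Defs.v *)
From mathcomp Require Import all_boot all_order all_algebra.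
Set Implicit Arguments.
Unset Strict Implicit.
Unset Printing Implicit Defensive.
Import Order.TTheory GRing.Theory Num.Theory.
Local Open Scope ring_scope.

(* A formal power series over rat is its coefficient sequence nat -> rat. *)
Definition fps_mul (f g : nat -> rat) : nat -> rat :=
  fun n => \sum_(i < n.+1) f i * g (n - i)%N.

Definition fps_X : nat -> rat := fun n => (n == 1%N)%:R.

(* exp(X) - 1 *)
Definition fps_expm1 : nat -> rat := fun n => (n`!)%:R^-1 - (n == 0%N)%:R.

Definition egf (B : nat -> rat) : nat -> rat := fun k => B k / (k`!)%:R.

(* sum_k B_k X^k/k! = X / (exp(X) - 1), with the denominator, which is not
   invertible as a power series, cleared; this determines B
   (bernoulli_egf_uniq). *)
Definition bernoulli_egf (B : nat -> rat) : Prop :=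
  fps_mul (egf B) fps_expm1 =1 fps_X.

Lemma fps_mul_expm1S (f : nat -> rat) (n : nat) :
  fps_mul f fps_expm1 n.+1 =
    f n + \sum_(i < n) f i * ((n.+1 - i)`!)%:R^-1.
Proof.
rewrite /fps_mul big_ord_recr /= subnn /fps_expm1 fact0 invr1 subrr mulr0 addr0.
rewrite big_ord_recr /= subSnn invr1 subr0 mulr1 addrC; congr (_ + _).
apply: eq_bigr => i _; have := ltn_ord i => lt_in.
by rewrite subSn ?(ltnW lt_in) //= subr0.
Qed.

Lemma bernoulli_egf_uniq (B C : nat -> rat) :
  bernoulli_egf B -> bernoulli_egf C -> B =1 C.
Proof.
move=> hB hC; elim/ltn_ind => n IHn.
have := hB n.+1; rewrite -(hC n.+1) !fps_mul_expm1S.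
rewrite (eq_bigr (fun i : 'I_n => egf C i * ((n.+1 - i)`!)%:R^-1)); last first.
  by move=> i _; rewrite /egf IHn.
move/addIr/(congr1 (fun x => x * (n`!)%:R)).
by rewrite /egf !mulfVK // pnatr_eq0 -lt0n fact_gt0.
Qed.

Fixpoint bernoulli_seq (n : nat) : seq rat :=
  if n is m.+1 then
    let s := bernoulli_seq m in
    rcons s ((m == 0%N)%:R - \sum_(i < m) s`_i * ((m.+1 - i)`!)%:R^-1)
  else [::].

Lemma bernoulli_exists : {B : nat -> rat | bernoulli_egf B}.
Proof.
pose b n := (bernoulli_seq n.+1)`_n.
have sz n : size (bernoulli_seq n) = n.
  by elim: n => //= n IHn; rewrite size_rcons IHn.
have nb n i : (i < n)%N -> (bernoulli_seq n)`_i = b i.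
  elim: n => // n IHn; rewrite ltnS leq_eqVlt => /orP[/eqP-> //|lt_in].
  by rewrite /= nth_rcons sz lt_in IHn.
exists (fun n => b n * (n`!)%:R) => -[|n].
  by rewrite /fps_mul big_ord1 /fps_expm1 /fps_X subnn fact0 invr1 subrr mulr0.
have egfE i : egf (fun n => b n * (n`!)%:R) i = b i.
  by rewrite /egf mulfK // pnatr_eq0 -lt0n fact_gt0.
rewrite fps_mul_expm1S egfE {1}/b /= nth_rcons sz ltnn eqxx /fps_X eqSS.
rewrite -addrA addrC [X in X + _ = _]addrC.
rewrite (eq_bigr (fun i : 'I_n => b i * ((n.+1 - i)`!)%:R^-1)).
  by rewrite [in X in _ - X](eq_bigr (fun i : 'I_n => b i * ((n.+1 - i)`!)%:R^-1))
     ?subrr ?add0r // => i _; rewrite nb.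
by move=> i _; rewrite egfE.
Qed.

Definition bernoulli : nat -> rat := sval bernoulli_exists.

Lemma bernoulliP : bernoulli_egf bernoulli.
Proof. exact: svalP bernoulli_exists. Qed.

Lemma bernoulli0 : bernoulli 0 = 1.
Proof.
have := bernoulliP 1; rewrite fps_mul_expm1S big_ord0 addr0 /egf fact0.
by rewrite divr1.
Qed.

Lemma bernoulli1 : bernoulli 1 = - (1 / 2).
Proof.
have := bernoulliP 2; rewrite fps_mul_expm1S big_ord1 /egf /= bernoulli0.
by rewrite /fps_X /= !divr1 !mul1r => /eqP; rewrite addr_eq0 => /eqP.
Qed.

Lemma bernoulli2 : bernoulli 2 = 1 / 6.
Proof.
have := bernoulliP 3; rewrite fps_mul_expm1S !big_ord_recl big_ord0 /egf /=.
rewrite bernoulli0 bernoulli1 /fps_X /= => /eqP.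
by rewrite addr_eq0 => /eqP /(congr1 (fun x => x * 2)); rewrite mulfVK.
Qed.

(* a = b (mod p^e) in the rationals with denominator prime to p;
   numq and denq are those of the reduced form. *)
Definition eqmodq (p e : nat) (a b : rat) : Prop :=
  ((p ^ e)%N%:Z %| numq (a - b))%Z /\ coprimez (denq (a - b)) p%:Z.

Definition wolstenholme_prime (p : nat) : Prop :=
  prime p /\ 'C(2 * p - 1, p - 1) = 1 %[mod p ^ 4].

(* Main.v *)
Require Import Defs.
From HB Require Import structures.
From mathcomp Require Import all_boot all_order all_algebra.
From mathcomp Require Import ring zify.
Set Implicit Arguments.
Unset Strict Implicit.
Unset Printing Implicit Defensive.
Import Order.TTheory GRing.Theory Num.Theory.
Local Open Scope ring_scope.

(** Write H_k for the sum of j^-k and S_m for the sum of j^m, over 0 < j < p.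
    Everything happens in the ring of rationals with denominator prime to p.

    The binomial coefficient is the product of the 1 + p/j. As p is odd, the
    product of the 1 - p/j is 1, and multiplying by it gives the product of
    the 1 - p^2/j^2 (central_binomial_prod). Expanding in elementary symmetric
    functions of the 1/j^2 and using that p divides H_2, H_4 and H_6, the
    hypothesis that the binomial is 1 modulo p^4 becomes p^2 | H_2, and then
    the binomial is 1 - p^2 H_2 - p^4 H_4 / 2 modulo p^7
    (binomial_harmonic_congq). What remains is to know H_2 modulo p^5 and H_4
    modulo p^3.

    Two facts turn negative powers into Bernoulli numbers. If q_j is the Fermat
    quotient (j^(p-1) - 1)/p and Q_k is the sum of the q_j j^-k, then
    j^(p^e (p-1)) = 1 + p^(e+1) q_j modulo p^(e+2), so that with
    m = p^e (p-1) - k, S_m = H_k + p^(e+1) Q_k modulo p^(e+2)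
    (power_sum_congq). And Faulhaber's formula, with the integrality of p B_n,
    gives S_m = p B_m + C(m,2)/3 p^3 B_(m-2) + ... for even m
    (faulhaber_truncation).

    Kummer's congruences between Bernoulli numbers are replaced by one
    relation between H_k and Q_k, namely H_k = k p Q_k modulo p^2
    (harmonic_sum_quotient): the p-th powers j^p represent, modulo p^2, the
    group of roots of unity of order p-1, so the sum of the j^(-kp) vanishes
    modulo p^2, while j^p = j (1 + p q_j).

    For k = 2, p^2 | H_2 forces p | Q_2, whence S_m = H_2 modulo p^5 for
    m = p^3 (p-1) - 2, and H_2 = p B_m + p^2 H_4 modulo p^5
    (harmonic_sum2_bernoulli). For k = 4, eliminating Q_4 between e = 1 and
    e = 0 expresses H_4 modulo p^3 by B_(p^2-p-4) and B_(p-5)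
    (harmonic_sum4_bernoulli). Substituting these gives the theorem.

    The primes up to 7 do not satisfy the hypothesis. For larger p the numbers
    2^k - 1 with k = 2, 4, 6 are prime to p, which is what makes p divide H_2,
    H_4 and H_6, and the Bernoulli numbers that occur are p-integral. *)

(** * Rationals with denominator prime to p, and their congruences *)

Definition p_integral (p : nat) : {pred rat} :=
  [pred x | coprimez (denq x) p%:Z].

(** The fraction need not be reduced: sums and products of fractions are not,
    even when the arguments are. *)
Lemma p_integral_frac p (a b : int) :
  coprimez b p%:Z -> a%:~R / b%:~R \in p_integral p.
Proof.
move=> cop_bp; rewrite inE; set x := _ / _.
have [b0|nz_b] := eqVneq b 0.
  by rewrite /x b0 invr0 mulr0 /coprimez gcd1z.
apply: coprimez_dvdl cop_bp.
have: (denq x %| numq x * b)%Z.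
  apply/dvdzP; exists a; apply: (@intr_inj rat).
  by rewrite !rmorphM /= numqE /x mulrAC divfK // intr_eq0.
by rewrite Gauss_dvdzr // coprimez_sym /coprimez; have := coprime_num_den x.
Qed.

Lemma p_integral_subring p : subring_closed (p_integral p).
Proof.
have nzd (x : rat) : (denq x)%:~R != 0 :> rat by rewrite intr_eq0 denq_neq0.
split=> [|x y|x y]; first by rewrite inE /coprimez gcd1z.
- rewrite !inE => hx hy.
  rewrite -[x]divq_num_den -[y]divq_num_den.
  have -> : (numq x)%:~R / (denq x)%:~R - (numq y)%:~R / (denq y)%:~R =
      (numq x * denq y - numq y * denq x)%:~R / (denq x * denq y)%:~R :> rat.
    by rewrite rmorphB !rmorphM /=; field; rewrite !nzd.
  by apply: p_integral_frac; rewrite coprimezMl hx.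
- rewrite !inE => hx hy.
  rewrite -[x]divq_num_den -[y]divq_num_den mulf_div -!rmorphM /=.
  by apply: p_integral_frac; rewrite coprimezMl hx.
Qed.

HB.instance Definition _ p :=
  GRing.isSubringClosed.Build rat (p_integral p) (p_integral_subring p).

Lemma p_integralV p (n : nat) : coprime n p -> n%:R^-1 \in p_integral p.
Proof. by move=> cop; rewrite -[_^-1]mul1r (@p_integral_frac p 1 n%:Z). Qed.

Definition congq (p e : nat) (x y : rat) : bool :=
  (x - y) / p%:R ^+ e \in p_integral p.

Lemma congq_intro p e x y z :
  z \in p_integral p -> x = y + p%:R ^+ e * z -> congq p e x y.
Proof.
move=> hz ->; rewrite /congq addrC addKr.
have [->|nz] := eqVneq (p%:R ^+ e : rat) 0; last by rewrite mulrC mulKf.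
by rewrite !mul0r rpred0.
Qed.

Lemma congq_refl p e x : congq p e x x.
Proof. by rewrite /congq subrr mul0r rpred0. Qed.

Lemma congq_sym p e x y : congq p e x y -> congq p e y x.
Proof. by rewrite /congq -opprB mulNr rpredN. Qed.

Lemma congq_trans p e y x z : congq p e x y -> congq p e y z -> congq p e x z.
Proof.
rewrite /congq => hxy hyz.
by rewrite -(subrK y x) -addrA mulrDl rpredD.
Qed.

Lemma congqD p e x y x' y' :
  congq p e x y -> congq p e x' y' -> congq p e (x + x') (y + y').
Proof. by move=> h h'; rewrite /congq opprD addrACA mulrDl rpredD. Qed.

Lemma congqN p e x y : congq p e x y -> congq p e (- x) (- y).
Proof. by rewrite /congq -opprD mulNr rpredN. Qed.

Lemma congqB p e x y x' y' :
  congq p e x y -> congq p e x' y' -> congq p e (x - x') (y - y').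
Proof. by move=> h h'; apply: congqD => //; apply: congqN. Qed.

Lemma congq_sum p e (I : eqType) (r : seq I) (F G : I -> rat) :
    (forall i, i \in r -> congq p e (F i) (G i)) ->
  congq p e (\sum_(i <- r) F i) (\sum_(i <- r) G i).
Proof.
move=> h; rewrite big_seq [X in congq _ _ _ X]big_seq.
by apply: (big_ind2 (congq p e)); [exact: congq_refl | exact: congqD |].
Qed.

Lemma congq_sum0 p e (I : eqType) (r : seq I) (F : I -> rat) :
  (forall i, i \in r -> congq p e (F i) 0) -> congq p e (\sum_(i <- r) F i) 0.
Proof. by move/congq_sum/congq_trans; apply; rewrite big1 ?congq_refl. Qed.

Lemma congqMl p e z x y :
  z \in p_integral p -> congq p e x y -> congq p e (z * x) (z * y).
Proof. by rewrite /congq -mulrBr -mulrA => *; rewrite rpredM. Qed.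

Lemma congqM p e x y x' y' :
    x \in p_integral p -> y' \in p_integral p ->
  congq p e x y -> congq p e x' y' -> congq p e (x * x') (y * y').
Proof.
move=> hx hy' hxy hxy'; apply: congq_trans (congqMl hx hxy') _.
by rewrite ![_ * y']mulrC; apply: congqMl.
Qed.

(** * Bernoulli numbers and Faulhaber's formula *)

Lemma bernoulli_rec n :
  (0 < n)%N -> \sum_(i < n) 'C(n, i)%:R * bernoulli i = (n == 1%N)%:R.
Proof.
case: n => // m _; have := bernoulliP m.+1; rewrite fps_mul_expm1S /fps_X => h.
transitivity ((m.+1)`!%:R * ((m.+1 == 1%N)%:R : rat)); last first.
  by case: m {h} => [|m]; rewrite ?mulr1 // mulr0.
have -> : (m.+1 == 1%N)%:R =
    \sum_(i < m.+1) egf bernoulli i * ((m.+1 - i)`!)%:R^-1 :> rat.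
  by rewrite -h big_ord_recr /= subSnn invr1 mulr1 addrC.
rewrite mulr_sumr; apply: eq_bigr => i _.
have nzf k : (k`!)%:R != 0 :> rat by rewrite pnatr_eq0 -lt0n fact_gt0.
have le_i : (i <= m.+1)%N by apply: ltnW.
rewrite -(bin_fact le_i) !natrM /egf.
by field; rewrite !nzf.
Qed.

Definition bernoulli_poly n (x : rat) : rat :=
  \sum_(i < n.+1) 'C(n, i)%:R * bernoulli i * x ^+ (n - i).

(** Expand (x + 1)^(n-i) and exchange the sums: the coefficient of x^l is
    C(n,l) times the recurrence for index n - l, which vanishes unless
    l = n - 1. *)
Lemma bernoulli_polyS n x :
  bernoulli_poly n (x + 1) - bernoulli_poly n x = n%:R * x ^+ n.-1.
Proof.
rewrite /bernoulli_poly -sumrB.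
have E (i : 'I_n.+1) : 'C(n, i)%:R * bernoulli i * (x + 1) ^+ (n - i)
      - 'C(n, i)%:R * bernoulli i * x ^+ (n - i)
    = \sum_(l < n | (i < n - l)%N)
        'C(n, l)%:R * x ^+ l * ('C(n - l, i)%:R * bernoulli i).
  have le_in : (i <= n)%N by rewrite -ltnS.
  rewrite -mulrBr [x + 1]addrC exprDn big_ord_recr /= subnn mul1r binn mulr1n addrK.
  rewrite mulr_sumr (big_ord_widen_cond n xpredT
    (fun l => 'C(n, i)%:R * bernoulli i * (1 ^+ (n - i - l) * x ^+ l *+ 'C(n - i, l)))) ?leq_subr //.
  apply: eq_big => l; first by lia.
  move=> lt_l; rewrite expr1n mul1r -[x ^+ l *+ _]mulr_natl.
  have -> : 'C(n, i)%:R * bernoulli i * ('C(n - i, l)%:R * x ^+ l) =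
     ('C(n, i) * 'C(n - i, l))%N%:R * bernoulli i * x ^+ l by rewrite natrM; ring.
  have -> : ('C(n, i) * 'C(n - i, l) = 'C(n, l) * 'C(n - l, i))%N.
    apply/eqP; rewrite -(@eqn_pmul2r (i`! * l`! * (n - i - l)`!)) ?muln_gt0 ?fact_gt0 //.
    have h1 := bin_fact le_in; have h2 := @bin_fact (n - i) l.
    have h3 := @bin_fact n l; have h4 := @bin_fact (n - l) i.
    have e : (n - l - i = n - i - l)%N by lia.
    rewrite e in h4.
    rewrite -(_ : n`! = 'C(n, i) * 'C(n - i, l) * _)%N; last by rewrite -h1 -h2 //; [ring | lia].
    rewrite -(_ : n`! = 'C(n, l) * 'C(n - l, i) * _)%N //; rewrite -h3 -?h4; [ring | lia | lia].
  by rewrite natrM; ring.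
rewrite (eq_bigr _ (fun i _ => E i)) (exchange_big_dep xpredT) //=.
have F (l : 'I_n) : \sum_(i < n.+1 | (i < n - l)%N)
      'C(n, l)%:R * x ^+ l * ('C(n - l, i)%:R * bernoulli i)
    = 'C(n, l)%:R * x ^+ l * (l.+1 == n)%:R.
  rewrite -mulr_sumr; congr (_ * _).
  have -> : (l.+1 == n) = (n - l == 1)%N by have := ltn_ord l; lia.
  rewrite -(big_ord_widen _ (fun i => 'C(n - l, i)%:R * bernoulli i)).
    by rewrite bernoulli_rec // subn_gt0.
  by rewrite leqW // leq_subr.
rewrite (eq_bigr _ (fun l _ => F l)).
case: n {E F} => [|n]; first by rewrite big_ord0 mul0r.
rewrite big_ord_recr /= eqxx mulr1 big1 ?add0r => [|i _].
  by rewrite -{2}(binSn n).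
by rewrite eqSS (ltn_eqF (ltn_ord i)) mulr0.
Qed.

Lemma bernoulli_poly0 n : bernoulli_poly n 0 = bernoulli n.
Proof.
rewrite /bernoulli_poly big_ord_recr /= subnn binn mul1r mulr1 big1 ?add0r // => i _.
by rewrite expr0n subn_eq0 leqNgt ltn_ord mulr0.
Qed.

(** The difference equation at x = -1 says that the numbers (-1)^i B_i satisfy
    the same recurrence as the B_i, up to a term that accounts for B_1. *)
Lemma bernoulli_odd n : odd n -> (1 < n)%N -> bernoulli n = 0.
Proof.
pose d i : rat := (-1) ^+ i * bernoulli i - bernoulli i - (i == 1%N)%:R.
have d0 i : d i = 0.
  elim/ltn_ind: i => i IHi; have h := bernoulli_polyS i.+1 (-1).
  have : \sum_(k < i.+1) 'C(i.+1, k)%:R * d k = 0.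
    have {}h : \sum_(k < i.+1) 'C(i.+1, k)%:R * ((-1) ^+ k * bernoulli k) = i.+1%:R.
      move: h; rewrite addNr bernoulli_poly0 /bernoulli_poly big_ord_recr /=.
      rewrite subnn binn mul1r mulr1 opprD addrCA subrr addr0.
      move/(congr1 (fun x => (-1) ^+ i.+1 * x)); rewrite mulrN mulr_sumr -sumrN.
      have sq k : (-1) ^+ k * (-1) ^+ k = 1 :> rat.
        by rewrite -exprD addnn -mul2n exprM sqrrN !expr1n.
      rewrite mulrCA exprS -mulrA sq mulr1 mulrN1 => h.
      apply: oppr_inj; rewrite -h -sumrN; apply: eq_bigr => k _.
      have le_k : (k <= i.+1)%N by rewrite ltnW.
      rewrite -exprS -[in X in _ = - (X * _)](subnK le_k) exprD; congr (- _).
      set a := (-1) ^+ (i.+1 - k); set b := (-1) ^+ k.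
      rewrite [RHS](_ : _ = a * a * ('C(i.+1, k)%:R * (b * bernoulli k))); last by ring.
      by rewrite sq mul1r.
    rewrite (eq_bigr (fun k : 'I_i.+1 => 'C(i.+1, k)%:R * ((-1) ^+ k * bernoulli k)
      - 'C(i.+1, k)%:R * bernoulli k - 'C(i.+1, k)%:R * (k == 1%N :> nat)%:R)); last first.
      by move=> k _; rewrite !mulrBr.
    rewrite !sumrB h bernoulli_rec //.
    case: (i) => [|i']; first by rewrite big_ord1 /= mulr0 subr0 subrr.
    rewrite !big_ord_recl big1 => [|k _]; last by rewrite mulr0.
    by rewrite /= bin1 mulr0 add0r mulr1 addr0 subrr.
  rewrite big_ord_recr /= big1 ?add0r => [|k _]; last by rewrite IHi ?mulr0.
  by move/eqP; rewrite mulf_eq0 pnatr_eq0 binSn => /= /eqP.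
move=> odd_n n_gt1; have := d0 n; rewrite /d -signr_odd odd_n expr1 gtn_eqF //.
rewrite mulN1r subr0 -opprD -mulr2n => /eqP.
by rewrite oppr_eq0 mulrn_eq0 => /eqP.
Qed.

Lemma faulhaber m n :
  \sum_(0 <= j < n) (j%:R : rat) ^+ m =
  \sum_(i < m.+1) 'C(m, i)%:R * bernoulli (m - i) * n%:R ^+ i.+1 / i.+1%:R.
Proof.
have nzm : m.+1%:R != 0 :> rat by rewrite pnatr_eq0.
apply: (mulfI nzm).
transitivity (bernoulli_poly m.+1 n%:R - bernoulli_poly m.+1 0).
  elim: n => [|n IHn]; first by rewrite big_geq // mulr0 subrr.
  rewrite big_nat_recr //= mulrDr IHn -(bernoulli_polyS m.+1) -natr1; ring.
rewrite bernoulli_poly0 /bernoulli_poly big_ord_recr /= subnn binn mul1r mulr1 addrK.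
rewrite (reindex_inj rev_ord_inj) mulr_sumr; apply: eq_bigr => i _ /=.
have lt_i := ltn_ord i.
have -> : (m.+1 - (m.+1 - i.+1) = i.+1)%N by lia.
rewrite bin_sub // subSS.
have nzi : i.+1%:R != 0 :> rat by rewrite pnatr_eq0.
have /(congr1 (fun k => k%:R : rat)) := mul_bin_diag m.+1 i.
rewrite !natrM /= => h.
have -> : 'C(m.+1, i.+1)%:R = m.+1%:R * 'C(m, i)%:R / i.+1%:R :> rat.
  by rewrite h [X in X / _]mulrC mulfK.
by move: (i.+1%:R^-1) => v; ring.
Qed.

(** * Powers and inverses under congruence *)

Section Congruences.

Variables (p : nat) (p_pr : prime p).
Local Notation P := (p%:R : rat).
Local Notation "x =[p^ e ] y" := (congq p e x y) (at level 70, e at level 50).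

Lemma natp_neq0 : P != 0.
Proof. by rewrite pnatr_eq0 -lt0n prime_gt0. Qed.
Local Notation nzP := natp_neq0.

Lemma congqE e x y :
  x =[p^ e] y -> exists2 z, z \in p_integral p & x = y + P ^+ e * z.
Proof.
move=> h; exists ((x - y) / P ^+ e) => //.
by rewrite mulrC divfK ?expf_neq0 ?nzP // addrC subrK.
Qed.

Lemma congq_integral e x y :
  x =[p^ e] y -> y \in p_integral p -> x \in p_integral p.
Proof.
by case/congqE=> z hz -> hy; rewrite rpredD // rpredM // rpredX // rpred_nat.
Qed.

Lemma congqX e n x y :
  y \in p_integral p -> x =[p^ e] y -> x ^+ n =[p^ e] y ^+ n.
Proof.
move=> hy hxy; have hx := congq_integral hxy hy.
by elim: n => [|n IHn]; rewrite ?congq_refl // !exprS congqM // rpredX.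
Qed.

Lemma congq_shift k e x y : (P ^+ k * x =[p^ k + e] P ^+ k * y) = (x =[p^ e] y).
Proof.
by rewrite /congq -mulrBr exprD invfM mulrACA divff ?mul1r // expf_neq0 ?nzP.
Qed.

Lemma congq_leq d e x y : (d <= e)%N -> x =[p^ e] y -> x =[p^ d] y.
Proof.
move=> le_de /congqE[z hz ->].
apply: (@congq_intro _ _ _ _ (P ^+ (e - d) * z)).
  by rewrite rpredM // rpredX // rpred_nat.
by rewrite mulrA -exprD subnKC.
Qed.

Lemma congq0 e x : (P ^+ e * x =[p^ e] 0) = (x \in p_integral p).
Proof. by rewrite /congq subr0 mulrC mulKf // expf_neq0 ?nzP. Qed.

Lemma congqV e x y :
    x^-1 \in p_integral p -> y^-1 \in p_integral p -> x != 0 -> y != 0 ->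
  x =[p^ e] y -> x^-1 =[p^ e] y^-1.
Proof.
move=> hx hy nzx nzy /congqE[z hz Dx].
apply: (@congq_intro _ _ _ _ (- (x^-1 * y^-1 * z))).
  by rewrite rpredN !rpredM.
rewrite [RHS](_ : _ = y^-1 * x^-1 * (x - P ^+ e * z)); last by field; rewrite nzx.
by rewrite Dx addrK mulrAC mulVf // mul1r.
Qed.

Lemma congq_cancel e z x y :
  z != 0 -> z^-1 \in p_integral p -> z * x =[p^ e] z * y -> x =[p^ e] y.
Proof. by move=> nz hz /(congqMl hz); rewrite !mulKf. Qed.

Lemma eqmodqP e x y : x =[p^ e] y -> eqmodq p e x y.
Proof.
rewrite /congq; set w := _ / _ => hw.
have Dx: x - y = (p ^ e)%N%:R * w by rewrite natrX mulrC divfK // expf_neq0 ?nzP.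
have cop : coprimez (denq (x - y)) p%:Z.
  have : x - y \in p_integral p by rewrite Dx rpredM ?rpred_nat.
  by rewrite inE.
split=> //.
have E : numq (x - y) * denq w = (p ^ e)%N%:Z * numq w * denq (x - y).
  apply: (@intr_inj rat); rewrite !rmorphM /= !numqE {1}Dx.
  by rewrite [LHS]mulrAC !mulrA.
have copw : coprimez (p ^ e)%N%:Z (denq w).
  by rewrite coprimezE coprimeXl // coprime_sym; move: hw; rewrite inE coprimezE.
by rewrite -(Gauss_dvdzl _ copw) E -mulrA dvdz_mulr.
Qed.

Ltac p_int := repeat match goal with
  | |- is_true (?x \in _) =>
    lazymatch x with
    | _ + _ => apply: rpredD
    | - _ => rewrite rpredN
    | _ ^+ _ => apply: rpredX
    | _ * _ => apply: rpredM
    | _%:R => apply: rpred_nat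
    | _ => assumption
    end
  end.

Lemma coprime_lt j : (0 < j < p)%N -> coprime j p.
Proof.
by case/andP=> j_gt0 lt_jp; rewrite coprime_sym prime_coprime // gtnNdvd.
Qed.

Lemma p_integral_natV j : (0 < j < p)%N -> j%:R^-1 \in p_integral p.
Proof. by move=> hj; apply: p_integralV; apply: coprime_lt. Qed.

(** In the binomial expansion the terms of index 2, ..., p-1 carry a factor p
    from the binomial coefficient and at least p^(2e) from the power; the term of index
    p carries p^(pe), where pe >= e + 2 because p is odd. *)
Lemma binomial_truncation e y z :
    (2 < p)%N -> (0 < e)%N -> y \in p_integral p -> z \in p_integral p ->
  (y + P ^+ e * z) ^+ p =[p^ e.+2] y ^+ p + P ^+ e.+1 * (y ^+ p.-1 * z).
Proof.
move=> p_gt2 e_gt0 hy hz.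
have Dp : p = p.-1.+1 by lia.
rewrite exprDn -(big_mkord xpredT (fun i => y ^+ (p - i) * (P ^+ e * z) ^+ i *+ 'C(p, i))).
rewrite big_nat_recl // subn0 expr0 mulr1 bin0 mulr1n.
apply: congqD (congq_refl _ _ _) _.
rewrite [X in index_iota 0 X]Dp big_nat_recl // expr1 bin1 subn1 -[X in congq _ _ _ X]addr0.
apply: congqD.
  rewrite -mulr_natl (_ : _ * _ = P ^+ e.+1 * (y ^+ p.-1 * z)) ?congq_refl //.
  by rewrite exprS; ring.
apply: congq_sum0 => i; rewrite mem_index_iota => /andP[_ lt_i].
set c := 'C(p, _); set n := (p - _)%N.
have [d [w [hd hw Dc]]] : exists d, exists w : rat,
   [/\ (e.+2 <= d + e * i.+2)%N, w \in p_integral p & c%:R = P ^+ d * w].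
  case: (ltnP i.+2 p) => [lt_ip|le_pi].
    exists 1%N; have /dvdnP[w Dw] : (p %| c)%N by apply: prime_dvd_bin; lia.
    by exists w%:R; rewrite rpred_nat Dw natrM mulrC expr1; split=> //; nia.
  by exists 0%N, c%:R; rewrite rpred_nat mul1r; split=> //; nia.
rewrite -mulr_natl Dc exprMn -exprM.
have -> : P ^+ d * w * (y ^+ n * (P ^+ (e * i.+2) * z ^+ i.+2)) =
  P ^+ (d + e * i.+2) * (w * (y ^+ n * z ^+ i.+2)) by rewrite exprD; ring.
apply: (congq_leq hd); rewrite congq0.
by rewrite rpredM // rpredM // rpredX.
Qed.

Lemma congq_expp e x y :
    (2 < p)%N -> (0 < e)%N -> y \in p_integral p ->
  x =[p^ e] y -> x ^+ p =[p^ e.+1] y ^+ p.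
Proof.
move=> p_gt2 e_gt0 hy /congqE[z hz ->].
have h := binomial_truncation p_gt2 e_gt0 hy hz.
apply: congq_trans (congq_leq (leqnSn _) h) _.
rewrite -[X in congq _ _ _ X]addr0; apply: congqD; first exact: congq_refl.
by rewrite congq0 rpredM // rpredX.
Qed.

Lemma congq_exppn e n x y :
    (2 < p)%N -> (0 < e)%N -> y \in p_integral p ->
  x =[p^ e] y -> x ^+ (p ^ n) =[p^ e + n] y ^+ (p ^ n).
Proof.
move=> p_gt2 e_gt0 hy hxy; elim: n => [|n IHn]; first by rewrite addn0.
rewrite expnSr !exprM addnS; apply: congq_expp => //; first lia.
by rewrite rpredX.
Qed.

Lemma congq_expp1 e u x :
    (2 < p)%N -> (0 < e)%N -> x \in p_integral p ->
  u =[p^ e.+1] 1 + P ^+ e * x -> u ^+ p =[p^ e.+2] 1 + P ^+ e.+1 * x.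
Proof.
move=> p_gt2 e_gt0 hx hu; apply: congq_trans.
  by apply: congq_expp hu => //; rewrite rpredD ?rpred1 // rpredM // rpredX // rpred_nat.
have := binomial_truncation p_gt2 e_gt0 (rpred1 _) hx.
by rewrite !expr1n mul1r.
Qed.

(** * Power sums, harmonic sums and Fermat quotients *)

Definition power_sum p m : rat := \sum_(1 <= j < p) j%:R ^+ m.

Definition harmonic_sum p k : rat := \sum_(1 <= j < p) (j%:R ^+ k)^-1.

Definition fermat_quotient p j : rat := (j%:R ^+ p.-1 - 1) / p%:R.

Definition quotient_sum p k : rat :=
  \sum_(1 <= j < p) fermat_quotient p j * (j%:R ^+ k)^-1.

(** The exponent that acts as -k on the units modulo p^(e+1), whose group has
    order p^e (p-1). *)
Definition neg_exp p (e k : nat) : nat := (p ^ e * p.-1 - k)%N.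

Lemma neg_exp_sub e k l : (neg_exp p e k - l)%N = neg_exp p e (k + l).
Proof. by rewrite /neg_exp subnDA. Qed.

Lemma leq_phi e : (p.-1 <= p ^ e * p.-1)%N.
Proof. by rewrite leq_pmull // expn_gt0 prime_gt0. Qed.

Lemma neg_exp_ge e k : (p.-1 - k <= neg_exp p e k)%N.
Proof. by rewrite leq_sub2r // leq_phi. Qed.

Lemma odd_neg_exp e k : (2 < p)%N -> (k < p.-1)%N -> odd (neg_exp p e k) = odd k.
Proof.
move=> p_gt2 lt_k; rewrite /neg_exp oddB; last exact: leq_trans (ltnW lt_k) (leq_phi e).
have odd_p : odd p by case: (even_prime p_pr) => // p2; move: p_gt2; rewrite p2.
by rewrite oddM -(subn1 p) oddB ?prime_gt0 // odd_p andbF.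
Qed.

Lemma p_integral_fermat_quotient j :
  (0 < j < p)%N -> fermat_quotient p j \in p_integral p.
Proof.
move=> hj; have cop := coprime_lt hj; have /andP[j_gt0 _] := hj.
have: (p %| j * (j ^ p.-1 - 1))%N.
  rewrite mulnBr muln1 -expnS prednK ?prime_gt0 // -eqn_mod_dvd.
    by apply/eqP; exact: fermat_little.
  by have := leq_pexp2l j_gt0 (prime_gt0 p_pr); rewrite expn1.
rewrite Gauss_dvdr 1?coprime_sym //.
case/dvdnP=> c Dc; rewrite /fermat_quotient.
have -> : (j%:R ^+ p.-1 - 1 : rat) = c%:R * P.
  by rewrite -natrM -Dc natrB ?natrX // expn_gt0 j_gt0.
by rewrite mulfK ?nzP // rpred_nat.
Qed.

Lemma quotient_sum_integral k : quotient_sum p k \in p_integral p.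
Proof.
rewrite /quotient_sum big_seq; apply: rpred_sum => j; rewrite mem_index_iota => hj.
by rewrite rpredM ?p_integral_fermat_quotient // -exprVn rpredX // p_integral_natV.
Qed.

(** Raising to the power p multiplies the distance to 1 by p, without
    changing the leading digit q_j. *)
Lemma euler_exp_congq e j :
    (2 < p)%N -> (0 < j < p)%N ->
  (j%:R : rat) ^+ (p ^ e * p.-1) =[p^ e.+2] 1 + P ^+ e.+1 * fermat_quotient p j.
Proof.
move=> p_gt2 hj; elim: e => [|e IHe].
  by rewrite mul1n expr1 /fermat_quotient mulrC divfK ?nzP // addrC subrK congq_refl.
rewrite expnSr -mulnA (mulnC p) mulnA exprM.
by apply: congq_expp1 => //; exact: p_integral_fermat_quotient.
Qed.

Lemma power_sum_congq e k :
    (2 < p)%N -> (k <= p ^ e * p.-1)%N ->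
  power_sum p (neg_exp p e k) =[p^ e.+2]
    harmonic_sum p k + P ^+ e.+1 * quotient_sum p k.
Proof.
move=> p_gt2 le_k; rewrite /neg_exp /power_sum /harmonic_sum /quotient_sum.
rewrite mulr_sumr -big_split /=; apply: congq_sum => j; rewrite mem_index_iota => hj.
have nzj : (j%:R : rat) != 0 by rewrite pnatr_eq0 -lt0n; case/andP: hj.
have -> : (j%:R : rat) ^+ (p ^ e * p.-1 - k) = (j%:R ^+ k)^-1 * j%:R ^+ (p ^ e * p.-1).
  by rewrite -{2}(subnK le_k) exprD mulrCA mulVf ?mulr1 // expf_neq0.
have -> : (j%:R ^+ k)^-1 + P ^+ e.+1 * (fermat_quotient p j * (j%:R ^+ k)^-1) =
  (j%:R ^+ k)^-1 * (1 + P ^+ e.+1 * fermat_quotient p j) by ring.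
apply: congqMl (euler_exp_congq _ p_gt2 hj).
by rewrite -exprVn rpredX // p_integral_natV.
Qed.

Lemma perm_double_modn :
  (2 < p)%N ->
  perm_eq [seq (2 * j) %% p | j <- index_iota 1 p]%N (index_iota 1 p).
Proof.
move=> p_gt2; have copp2 : coprime p 2 by rewrite prime_coprime // gtnNdvd.
have inj : {in index_iota 1 p &, injective (fun j => (2 * j) %% p)%N}.
  move=> i j; rewrite !mem_index_iota => /andP[_ lt_i] /andP[_ lt_j] /= /eqP.
  wlog le_ji : i j lt_i lt_j / (j <= i)%N.
    by move=> W; case/orP: (leq_total j i) => le; [|rewrite eq_sym => h; apply/esym; move: h]; apply: W.
  rewrite eqn_mod_dvd ?leq_mul2l // -mulnBr Gauss_dvdr // => dv.
  have [|d_gt0] := posnP (i - j)%N; first lia.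
  by move: dv; rewrite gtnNdvd // (leq_ltn_trans (leq_subr _ _) lt_i).
have sub : {subset [seq (2 * j) %% p | j <- index_iota 1 p]%N <= index_iota 1 p}.
  move=> _ /mapP[j hj ->]; move: hj; rewrite !mem_index_iota => /andP[j_gt0 lt_jp].
  rewrite ltn_mod (prime_gt0 p_pr) andbT lt0n; apply/negP => /eqP/eqP.
  by rewrite -/(dvdn _ _) Gauss_dvdr // gtnNdvd.
have uq : uniq [seq (2 * j) %% p | j <- index_iota 1 p]%N.
  by rewrite map_inj_in_uniq // iota_uniq.
apply: uniq_perm => //; first exact: iota_uniq.
by case: (uniq_min_size uq sub); rewrite ?size_map.
Qed.

Lemma double_unit k e :
  (2 < p)%N -> coprime (2 ^ k - 1) p -> coprime (2 ^ (k * p ^ e) - 1) p.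
Proof.
move=> p_gt2.
suff E : (2 ^ (k * p ^ e) - 1 = 2 ^ k - 1 %[mod p])%N.
  by rewrite -[coprime (2 ^ (k * p ^ e) - 1) p]coprime_modl E coprime_modl.
apply/eqP; rewrite -(eqn_modDr 1) !subnK ?expn_gt0 //; apply/eqP.
elim: e => [|e IHe]; first by rewrite muln1.
by rewrite expnSr mulnA expnM fermat_little.
Qed.

(** Modulo p^(e+1), j^(p^e) depends only on j modulo p. Permuting the residues
    by j -> 2j therefore multiplies the sum by the inverse of 2^(k p^e), which
    is 2^k modulo p, and not 1. *)
Lemma inverse_power_sum_congq0 k e :
    (2 < p)%N -> coprime (2 ^ k - 1) p ->
  \sum_(1 <= j < p) ((j%:R : rat) ^+ (k * p ^ e))^-1 =[p^ e.+1] 0.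
Proof.
move=> p_gt2 cop2; set K := (k * p ^ e)%N; set s := \sum_(1 <= j < p) _.
have nz2 : (2%:R : rat) ^+ K != 0 by rewrite expf_neq0.
have cop_unit j : (0 < j < p)%N -> (j%:R : rat) != 0.
  by rewrite pnatr_eq0 -lt0n => /andP[].
have E : s =[p^ e.+1] (2%:R ^+ K)^-1 * s.
  rewrite {1}/s -(perm_big _ (perm_double_modn p_gt2)) big_map /= mulr_sumr.
  apply: congq_sum => j hj.
  have: ((2 * j) %% p)%N \in index_iota 1 p.
    by rewrite -(perm_mem (perm_double_modn p_gt2)); apply: map_f.
  move: hj; rewrite !mem_index_iota; set i := (_ %% p)%N => hj hi.
  rewrite -invfM -exprMn -natrM.
  have hV (n m : nat) : coprime n p -> ((n%:R : rat) ^+ m)^-1 \in p_integral p.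
    by move=> cop; rewrite -exprVn rpredX // p_integralV.
  have cop2j : coprime (2 * j) p by rewrite coprimeMl !coprime_lt.
  apply: congqV; try by [apply: hV => //; apply: coprime_lt].
  - by rewrite expf_neq0 // cop_unit.
  - by rewrite expf_neq0 // natrM mulf_neq0 // cop_unit.
  rewrite /K mulnC !exprM; apply: congqX; first by rewrite rpredX // rpred_nat.
  rewrite -add1n; apply: congq_exppn => //; first exact: rpred_nat.
  apply: congq_sym; apply: (@congq_intro _ _ _ _ ((2 * j) %/ p)%N%:R); first exact: rpred_nat.
  by rewrite expr1 -natrM -natrD /i addnC (mulnC p) -divn_eq.
have {}E : 2%:R ^+ K * s =[p^ e.+1] s.
  by have := congqMl (rpredX K (rpred_nat (p_integral p) 2)) E; rewrite mulVKf.
apply: (@congq_cancel _ (2 ^ K - 1)%N%:R).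
- rewrite pnatr_eq0; apply/negP => /eqP D0; have := double_unit e p_gt2 cop2.
  by rewrite -/K D0 /coprime gcd0n => /eqP p1; move: p_gt2; rewrite p1.
- by rewrite p_integralV // double_unit.
rewrite mulr0 natrB ?expn_gt0 // natrX mulrBl mul1r -(subrr s).
by apply: congqB => //; apply: congq_refl.
Qed.

Lemma harmonic_sum_congq0 k :
  (2 < p)%N -> coprime (2 ^ k - 1) p -> harmonic_sum p k =[p^ 1] 0.
Proof.
move=> p_gt2 cop2; have := inverse_power_sum_congq0 0 p_gt2 cop2.
by rewrite expn0 muln1.
Qed.

(** Compare with the sum of the j^(-kp), which vanishes modulo p^2, by means of
    j^p = j (1 + p q_j). *)
Lemma harmonic_sum_quotient k :
    (2 < p)%N -> coprime (2 ^ k - 1) p ->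
  harmonic_sum p k =[p^ 2] k%:R * P * quotient_sum p k.
Proof.
move=> p_gt2 cop2; have := inverse_power_sum_congq0 1 p_gt2 cop2.
set s := \sum_(_ <= _ < _) _ => s0.
suff: harmonic_sum p k =[p^ 2] s + k%:R * P * quotient_sum p k.
  by move=> h; apply: congq_trans h _; rewrite -[X in congq _ _ _ X]add0r; apply: congqD => //; apply: congq_refl.
rewrite /harmonic_sum /quotient_sum /s mulr_sumr -big_split /=.
apply: congq_sum => j; rewrite mem_index_iota => hj.
have nzj : (j%:R : rat) != 0 by rewrite pnatr_eq0 -lt0n; case/andP: hj.
have hjV m : ((j%:R : rat) ^+ m)^-1 \in p_integral p.
  by rewrite -exprVn rpredX // p_integral_natV.
have hq := p_integral_fermat_quotient hj.
set q := fermat_quotient p j in hq *.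
have Dq : (j%:R : rat) ^+ p = j%:R * (1 + P * q).
  rewrite -{1}(prednK (prime_gt0 p_pr)) exprS /q /fermat_quotient.
  by rewrite [P * _]mulrC divfK ?nzP // [1 + _]addrC subrK.
have nzu : (1 + P * q) ^+ k != 0.
  apply: expf_neq0; apply/eqP => u0; move: Dq; rewrite u0 mulr0 => /eqP.
  by rewrite expf_eq0 (negPf nzj) andbF.
have expand : (1 + P * q) ^+ k =[p^ 2] 1 + k%:R * P * q.
  elim: (k) => [|n IHn]; first by rewrite !mul0r addr0 congq_refl.
  have hu : 1 + P * q \in p_integral p by rewrite rpredD ?rpred1 // rpredM // rpred_nat.
  rewrite exprS; apply: congq_trans (congqMl hu IHn) _.
  apply: (@congq_intro _ _ _ _ (n%:R * q * q)); first by rewrite rpredM // rpredM // rpred_nat.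
  by rewrite -natr1; ring.
pose t := ((j%:R : rat) ^+ (k * p ^ 1))^-1.
have Dt : (j%:R ^+ k)^-1 = t * (1 + P * q) ^+ k.
  by rewrite /t expn1 mulnC exprM Dq exprMn invfM divfK.
rewrite [X in congq _ _ X _]Dt -/t; apply: congq_trans (congqMl (hjV _) expand) _.
rewrite mulrDr mulr1; apply: congqD; first exact: congq_refl.
rewrite (_ : t * _ = P ^+ 1 * (k%:R * q * t)); last by rewrite expr1; ring.
rewrite (_ : k%:R * P * _ = P ^+ 1 * (k%:R * q * (j%:R ^+ k)^-1)); last by rewrite expr1; ring.
rewrite (congq_shift 1 1); apply: congqMl; first by rewrite rpredM // rpred_nat.
rewrite [X in congq _ _ _ X]Dt -[X in congq _ _ X _]mulr1.
apply: congqMl (hjV _) _; apply: (congq_sym).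
apply: congq_trans (congq_leq _ expand) _ => //.
apply: (@congq_intro _ _ _ _ (k%:R * q)); first by rewrite rpredM // rpred_nat.
by rewrite expr1; ring.
Qed.

Lemma coprime_mersenne k :
  (7 < p)%N -> k \in [:: 2; 4; 6]%N -> coprime (2 ^ k - 1) p.
Proof.
move=> p_gt7.
have c3 : coprime 3 p by apply: coprime_lt; lia.
have c5 : coprime 5 p by apply: coprime_lt; lia.
have c7 : coprime 7 p by apply: coprime_lt; lia.
rewrite !inE => /or3P[] /eqP->.
- exact: c3.
- by rewrite (_ : 2 ^ 4 - 1 = 3 * 5)%N // coprimeMl c3.
by rewrite (_ : 2 ^ 6 - 1 = 3 * (3 * 7))%N // !coprimeMl c3.
Qed.

(** * Faulhaber's formula modulo powers of p *)

(** If p^v divides i + 1 with v > 0, then i + 1 >= p^v >= v + p - 1. *)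
Lemma logn_succ_bound r i :
  (r.+2 <= p)%N -> (r <= i)%N -> (logn p i.+1 + r <= i)%N.
Proof.
move=> le_rp le_ri; have [->//|v_gt0] := posnP (logn p i.+1).
have le_pi : (p ^ logn p i.+1 <= i.+1)%N by apply: dvdn_leq => //; apply: pfactor_dvdnn.
suff: (logn p i.+1 + p <= p ^ logn p i.+1 + 1)%N by lia.
case: (logn p i.+1) v_gt0 => // v _; elim: v => [|v IHv]; first by rewrite expn1 addnC.
by rewrite expnS; nia.
Qed.

Lemma p_integral_pow_div r i :
    (r.+2 <= p)%N -> (r <= i)%N ->
  exists2 w, w \in p_integral p & P ^+ i / i.+1%:R = P ^+ r * w.
Proof.
move=> le_rp le_ri; have le_v := logn_succ_bound le_rp le_ri.
have [m cop_pm Dm] := pfactor_coprime p_pr (ltn0Sn i).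
exists (P ^+ (i - r - logn p i.+1) * m%:R^-1).
  by rewrite rpredM ?rpredX ?rpred_nat // p_integralV // coprime_sym.
have nzm : m%:R != 0 :> rat.
  by rewrite pnatr_eq0; apply/eqP => m0; move: Dm; rewrite m0.
set v := logn _ _ in le_v Dm *; rewrite Dm natrM natrX.
have {1}-> : (i = (r + (i - r - v)) + v)%N by lia.
by rewrite !exprD -mulrA [m%:R * _]mulrC invfM mulVKf ?expf_neq0 ?nzP // mulrA.
Qed.

Lemma power_sum_faulhaber m :
  (0 < m)%N -> power_sum p m =
  \sum_(0 <= i < m.+1) 'C(m, i)%:R * bernoulli (m - i) * P ^+ i.+1 / i.+1%:R.
Proof.
move=> m_gt0; rewrite big_mkord -faulhaber /power_sum.
by rewrite [RHS]big_ltn ?prime_gt0 // expr0n gtn_eqF // add0r.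
Qed.

Lemma faulhaber_tail r m i :
    (r.+2 <= p)%N -> (r <= i)%N -> P * bernoulli (m - i) \in p_integral p ->
  exists2 w, w \in p_integral p &
    'C(m, i)%:R * bernoulli (m - i) * P ^+ i.+1 / i.+1%:R = P ^+ r * w.
Proof.
move=> le_rp le_ri hB; have [w hw Dw] := p_integral_pow_div le_rp le_ri.
exists ('C(m, i)%:R * (P * bernoulli (m - i)) * w).
  by rewrite rpredM // rpredM // rpred_nat.
by rewrite exprS -!mulrA Dw; ring.
Qed.

(** The weak form of the von Staudt-Clausen theorem, by induction: in
    Faulhaber's formula for n = p every other term is integral. *)
Lemma p_bernoulli_integral m : P * bernoulli m \in p_integral p.
Proof.
elim/ltn_ind: m => -[_|m IHm]; first by rewrite bernoulli0 mulr1 rpred_nat.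
have hS : power_sum p m.+1 \in p_integral p.
  by apply: rpred_sum => j _; rewrite rpredX // rpred_nat.
move: hS; rewrite power_sum_faulhaber // big_ltn // bin0 mul1r subn0 divr1 expr1.
rewrite mulrC rpredDr //; rewrite big_seq; apply: rpred_sum => i.
rewrite mem_index_iota => /andP[i_gt0 le_i].
have lt_m : (m.+1 - i < m.+1)%N by rewrite ltn_subrL i_gt0.
have [w hw ->] := @faulhaber_tail 0 m.+1 i (prime_gt1 p_pr) (leq0n i) (IHm _ lt_m).
by rewrite mul1r.
Qed.

Lemma faulhaber_truncation r m :
    (r.+2 <= p)%N -> (0 < m)%N ->
  power_sum p m =[p^ r]
    \sum_(0 <= i < r) 'C(m, i)%:R * bernoulli (m - i) * P ^+ i.+1 / i.+1%:R.
Proof.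
move=> le_rp m_gt0; rewrite power_sum_faulhaber //.
pose F i : rat := 'C(m, i)%:R * bernoulli (m - i) * P ^+ i.+1 / i.+1%:R.
pose n := maxn r m.+1.
have -> : \sum_(0 <= i < m.+1) 'C(m, i)%:R * bernoulli (m - i) * P ^+ i.+1 / i.+1%:R =
    \sum_(0 <= i < n) F i.
  rewrite [RHS](@big_cat_nat _ _ _ m.+1) ?leq_maxr //= [X in _ = _ + X]big1_seq ?addr0 // => i.
  by rewrite mem_index_iota => /andP[_ /andP[lt_mi _]]; rewrite /F bin_small // !mul0r.
rewrite [X in congq _ _ X _](@big_cat_nat _ _ _ r) ?leq_maxl //= -[X in congq _ _ _ X]addr0.
apply: congqD (congq_refl _ _ _) _; apply: congq_sum0 => i.
rewrite mem_index_iota => /andP[le_ri _].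
rewrite /F.
by have [w hw ->] := faulhaber_tail le_rp le_ri (p_bernoulli_integral (m - i)); rewrite congq0.
Qed.

Lemma bernoulli_integral m :
    (2 < p)%N -> (0 < m)%N -> power_sum p m =[p^ 1] 0 ->
  bernoulli m \in p_integral p.
Proof.
move=> p_gt2 m_gt0 S0; rewrite -(congq0 1); apply: congq_trans S0.
apply: congq_sym; apply: congq_trans (@faulhaber_truncation 1 _ _ _) _ => //.
by rewrite big_nat1 bin0 mul1r subn0 divr1 mulrC congq_refl.
Qed.

(** For even m the terms of odd index i in Faulhaber's formula vanish, as m - i
    is then odd and larger than 1; the same holds in the next two lemmas. *)
Lemma power_sum_bernoulli2 m :
    (3 < p)%N -> ~~ odd m -> (2 < m)%N -> power_sum p m =[p^ 2] P * bernoulli m.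
Proof.
move=> p_gt3 even_m m_gt2; apply: congq_trans (@faulhaber_truncation 2 _ _ _) _; try lia.
rewrite 2?big_ltn // big_geq // subn0 bin0 (@bernoulli_odd (m - 1)); try lia.
by rewrite mul1r divr1 mulrC mulr0 !mul0r !addr0 congq_refl.
Qed.

(** The term of index 2 is a multiple of p^3 B_(m-2), hence the hypothesis. *)
Lemma power_sum_bernoulli3 m :
    (4 < p)%N -> ~~ odd m -> (2 < m)%N -> bernoulli (m - 2) \in p_integral p ->
  power_sum p m =[p^ 3] P * bernoulli m.
Proof.
move=> p_gt4 even_m m_gt2 hB; apply: congq_trans (@faulhaber_truncation 3 _ _ _) _; try lia.
rewrite 3?big_ltn // big_geq // subn0 bin0 (@bernoulli_odd (m - 1)); try lia.
rewrite mul1r divr1 mulrC mulr0 !mul0r !addr0 add0r.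
rewrite -[X in congq _ _ _ X]addr0; apply: congqD (congq_refl _ _ _) _.
rewrite (_ : _ / _ = P ^+ 3 * ('C(m, 2)%:R * bernoulli (m - 2) / 3%:R)); last by ring.
rewrite congq0 rpredM // ?rpredM ?rpred_nat // p_integral_natV //; lia.
Qed.

Lemma power_sum_bernoulli5 m :
    (6 < p)%N -> ~~ odd m -> (4 < m)%N -> bernoulli (m - 4) \in p_integral p ->
  power_sum p m =[p^ 5]
    P * bernoulli m + P ^+ 3 * ('C(m, 2)%:R / 3 * bernoulli (m - 2)).
Proof.
move=> p_gt6 even_m m_gt2 hB; apply: congq_trans (@faulhaber_truncation 5 _ _ _) _; try lia.
rewrite 5?big_ltn // big_geq // subn0 bin0 (@bernoulli_odd (m - 1)); try lia.
rewrite (@bernoulli_odd (m - 3)); try lia.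
rewrite mul1r divr1 !mulr0 !mul0r !addr0 !add0r [P ^+ 1 in X in congq _ _ X _]expr1.
rewrite addrA -[X in congq _ _ _ X]addr0; apply: congqD.
  rewrite (_ : bernoulli m * P + _ = P * bernoulli m
    + P ^+ 3 * ('C(m, 2)%:R / 3 * bernoulli (m - 2))) ?congq_refl //; ring.
rewrite (_ : _ / _ = P ^+ 5 * ('C(m, 4)%:R * bernoulli (m - 4) / 5%:R)); last by ring.
rewrite congq0 rpredM // ?rpredM ?rpred_nat // p_integral_natV //; lia.
Qed.

(** * The binomial coefficient in terms of harmonic sums *)

(** The first three elementary symmetric functions of the a_i in terms of
    power sums; the factor 6 avoids the denominators in Newton's identities. *)
Lemma prod_one_sub_expansion (I : eqType) (s : seq I) (a : I -> rat) y :
    (forall i, i \in s -> a i \in p_integral p) -> y \in p_integral p ->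
  let s1 := \sum_(i <- s) a i in
  let s2 := \sum_(i <- s) a i ^+ 2 in
  let s3 := \sum_(i <- s) a i ^+ 3 in
  exists2 r, r \in p_integral p &
    6 * \prod_(i <- s) (1 - y * a i) =
      6 - 6 * y * s1 + 3 * y ^+ 2 * (s1 ^+ 2 - s2)
      - y ^+ 3 * (s1 ^+ 3 - 3 * s1 * s2 + 2 * s3) + y ^+ 4 * r.
Proof.
move=> + hy /=; elim: s => [|i s IHs] ha.
  by exists 0; rewrite ?rpred0 // !big_nil; ring.
have hai := ha i (mem_head _ _).
have has j : j \in s -> a j \in p_integral p by move=> js; rewrite ha // inE js orbT.
have [r hr Dr] := IHs has; rewrite !big_cons.
have h n : \sum_(j <- s) a j ^+ n \in p_integral p.
  by rewrite big_seq; apply: rpred_sum => j /has; apply: rpredX.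
have h1 : \sum_(j <- s) a j \in p_integral p.
  by rewrite big_seq; apply: rpred_sum => j /has.
set s1 := \sum_(j <- s) a j in h1 Dr *.
have h2 := h 2%N; set s2 := \sum_(j <- s) a j ^+ 2 in h2 Dr *.
have h3 := h 3%N; set s3 := \sum_(j <- s) a j ^+ 3 in h3 Dr *.
exists (r * (1 - y * a i) + a i * (s1 ^+ 3 - 3 * s1 * s2 + 2 * s3)).
  rewrite rpredD //; first by rewrite rpredM // rpredB ?rpred1 // rpredM.
  rewrite rpredM // rpredD //; last by rewrite rpredM // rpred_nat.
  by rewrite rpredB // ?rpredX // rpredM // rpredM // rpred_nat.
by rewrite mulrCA Dr; ring.
Qed.

(** Multiply the product of the p + j, over (p-1)!, by the product of the
    p - j, also over (p-1)!, and count the p - 1 signs. *)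
Lemma central_binomial_prod :
  (2 < p)%N ->
  'C(2 * p - 1, p - 1)%:R =
    \prod_(1 <= j < p) (1 - P ^+ 2 * (j%:R ^+ 2)^-1) :> rat.
Proof.
move=> p_gt2.
have nzj j : (0 < j)%N -> j%:R != 0 :> rat by rewrite pnatr_eq0 lt0n.
have facE : (p.-1)`! = (\prod_(1 <= j < p) j)%N by rewrite fact_prod prednK ?prime_gt0.
have E : ('C(2 * p - 1, p - 1) * (p.-1)`! = \prod_(1 <= j < p) (p + j))%N.
  apply/eqP; rewrite -(@eqn_pmul2r p`!) ?fact_gt0 // -mulnA (subn1 p).
  have := @bin_fact (2 * p - 1) p.-1; rewrite (_ : 2 * p - 1 - p.-1 = p)%N; last lia.
  move=> -> //; last lia.
  rewrite fact_prod (_ : (2 * p - 1).+1 = p.-1 + p.+1)%N; last lia.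
  rewrite (@big_cat_nat _ _ _ p.+1) //=; last lia.
  rewrite -fact_prod mulnC; apply/eqP; congr (_ * _)%N.
  rewrite -{1}[p.+1]add0n big_addn addnK -[in RHS](prednK (prime_gt0 p_pr)) big_add1 /=.
  by apply: eq_bigr => j _; lia.
have F : (p.-1)`! = (\prod_(1 <= j < p) (p - j))%N.
  by rewrite facE big_nat_rev /=; apply: eq_bigr => j _; rewrite add1n subSS.
have nzf : (\prod_(1 <= j < p) (j%:R : rat) ^+ 2) != 0.
  rewrite prodf_seq_neq0; apply/allP => j; rewrite mem_index_iota => /andP[j_gt0 _].
  by rewrite expf_neq0 // nzj.
apply: (mulIf nzf); rewrite -big_split /=.
have -> : \prod_(1 <= j < p) (j%:R : rat) ^+ 2 = (p.-1)`!%:R * (p.-1)`!%:R.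
  by rewrite facE natr_prod -big_split; apply: eq_bigr => j _; rewrite expr2.
rewrite {2}F mulrA -natrM E !natr_prod -big_split /=.
have sgn : \prod_(1 <= j < p) (-1) = 1 :> rat.
  rewrite prodr_const_nat -signr_odd.
  by have [/eqP|odd_p] := even_prime p_pr; [rewrite gtn_eqF | rewrite oddB ?prime_gt0 // odd_p].
rewrite -[LHS]mul1r -[X in X * _ = _]sgn -big_split /=; apply: eq_big_nat => j /andP[j_gt0 lt_jp].
by rewrite natrD natrB 1?ltnW //; field; apply: nzj.
Qed.

(** With y = p^2 in the expansion, every term beyond the second power sum is
    divisible by p^7 once H_2 is divisible by p^2; that divisibility is the
    hypothesis, read modulo p^4. *)
Lemma binomial_harmonic_congq :
    (7 < p)%N -> ('C(2 * p - 1, p - 1)%:R : rat) =[p^ 4] 1 ->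
  harmonic_sum p 2 =[p^ 2] 0 /\
  ('C(2 * p - 1, p - 1)%:R : rat) =[p^ 7]
    1 - P ^+ 2 * harmonic_sum p 2 - P ^+ 4 * harmonic_sum p 4 / 2.
Proof.
move=> p_gt7; have p_gt2 : (2 < p)%N by lia.
have H0 k : k \in [:: 2; 4; 6]%N ->
    exists2 h, h \in p_integral p & harmonic_sum p k = P * h.
  move/(coprime_mersenne p_gt7)/(harmonic_sum_congq0 p_gt2)/congqE => [h hh ->].
  by exists h; rewrite // add0r expr1.
have [h2 hh2 D2] := H0 2%N isT.
have [h4 hh4 D4] := H0 4%N isT.
have [h6 hh6 D6] := H0 6%N isT.
have i6 : (6%:R : rat)^-1 \in p_integral p.
  by rewrite p_integral_natV //; lia.
have [r hr] : exists2 r, r \in p_integral p &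
    6 * 'C(2 * p - 1, p - 1)%:R =
      6 - 6 * P ^+ 2 * harmonic_sum p 2
      + 3 * P ^+ 4 * (harmonic_sum p 2 ^+ 2 - harmonic_sum p 4)
      - P ^+ 6 * (harmonic_sum p 2 ^+ 3 - 3 * harmonic_sum p 2 * harmonic_sum p 4
                  + 2 * harmonic_sum p 6) + P ^+ 8 * r.
  rewrite central_binomial_prod //.
  have hP2 : P ^+ 2 \in p_integral p by rewrite rpredX // rpred_nat.
  have ha j : j \in index_iota 1 p -> ((j%:R : rat) ^+ 2)^-1 \in p_integral p.
    by rewrite mem_index_iota => hj; rewrite -exprVn rpredX // p_integral_natV.
  have [r hr ->] := prod_one_sub_expansion ha hP2; exists r => //.
  have e n : \sum_(1 <= j < p) (((j%:R : rat) ^+ 2)^-1) ^+ n = harmonic_sum p (2 * n).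
    by apply: eq_bigr => j _; rewrite exprVn -exprM.
  by rewrite -/(harmonic_sum p 2) !e; ring.
set C := 'C(_, _)%:R; rewrite D2 D4 D6 => DC /congqE[c hc Dc].
(* Solve the expansion for h2: every term but 6 p^3 h2 is divisible by p^4. *)
have [g hg Dg] : exists2 g, g \in p_integral p & h2 = P * g.
  exists (6^-1 * (- (6 * c) + 3 * (P ^+ 2 * h2 ^+ 2) - 3 * (P * h4) - P ^+ 5 * h2 ^+ 3
    + 3 * (P ^+ 4 * (h2 * h4)) - 2 * (P ^+ 3 * h6) + P ^+ 4 * r)); first by p_int.
  apply: (@mulfI _ (6 * P ^+ 3)); first by rewrite mulf_neq0 // expf_neq0 ?nzP.
  apply/eqP; rewrite -subr_eq0; move/eqP: DC; rewrite -subr_eq0 Dc.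
  by congr (_ == _); field.
split.
  rewrite Dg (_ : P * (P * g) = P ^+ 2 * g); last by ring.
  by rewrite congq0.
apply: (@congq_intro _ _ _ _ (6^-1 * (3 * P * g ^+ 2 - (P ^+ 5 * g ^+ 3 - 3 * P ^+ 2 * g * h4 + 2 * h6) + P * r))).
  by p_int.
apply: (@mulfI _ 6) => //; rewrite DC Dg; by field.
Qed.

(** * Harmonic sums in terms of Bernoulli numbers *)

(** S_m is H_k modulo p, hence zero, and p B_m is S_m modulo p. *)
Lemma bernoulli_neg_integral e k :
    (2 < p)%N -> (k < p.-1)%N -> coprime (2 ^ k - 1) p ->
  bernoulli (neg_exp p e k) \in p_integral p.
Proof.
move=> p_gt2 lt_k copk; apply: bernoulli_integral => //.
  by apply: leq_trans (neg_exp_ge e k); rewrite subn_gt0.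
apply: congq_trans (harmonic_sum_congq0 p_gt2 copk).
have le_k : (k <= p ^ e * p.-1)%N := leq_trans (ltnW lt_k) (leq_phi e).
apply: congq_trans (congq_leq _ (power_sum_congq p_gt2 le_k)) _ => //.
rewrite -[X in congq _ _ _ X]addr0; apply: congqD (congq_refl _ _ _) _.
rewrite exprS -mulrA -{1}[P]expr1 congq0 rpredM ?quotient_sum_integral //.
by rewrite rpredX // rpred_nat.
Qed.

(** With b = B_(p-5), the cases e = 0 and e = 1 of the power sum congruence
    read p b = H_4 + p Q_4 modulo p^2 and p B_(p^2-p-4) = H_4 + p^2 Q_4
    modulo p^3. Since H_4 = 4 p Q_4 modulo p^2, the former gives b = 5 Q_4
    modulo p. *)
Lemma harmonic_sum4_bernoulli :
  (7 < p)%N ->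
  harmonic_sum p 4 =[p^ 3]
    P * bernoulli (neg_exp p 1 4) - P ^+ 2 * (bernoulli (neg_exp p 0 4) / 5).
Proof.
move=> p_gt7; have p_gt2 : (2 < p)%N by lia.
have [lt4 lt6] : (4 < p.-1)%N /\ (6 < p.-1)%N by lia.
have gt2 e : (2 < neg_exp p e 4)%N by apply: leq_trans (neg_exp_ge e 4); lia.
have even4 e : ~~ odd (neg_exp p e 4) by rewrite odd_neg_exp.
have le4 e : (4 <= p ^ e * p.-1)%N := leq_trans (ltnW lt4) (leq_phi e).
have cop k := @coprime_mersenne k p_gt7.
have i5 : (5%:R : rat)^-1 \in p_integral p by rewrite p_integral_natV //; lia.
have hQ := quotient_sum_integral 4.
have [x hx Dx] : exists2 x, x \in p_integral p & P * bernoulli (neg_exp p 1 4) =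
    harmonic_sum p 4 + P ^+ 2 * quotient_sum p 4 + P ^+ 3 * x.
  apply: congqE; apply: congq_trans (power_sum_congq p_gt2 (le4 1%N)).
  apply: congq_sym; apply: power_sum_bernoulli3 => //; first lia.
  by rewrite neg_exp_sub bernoulli_neg_integral // cop.
have [y hy Dy] : exists2 y, y \in p_integral p & P * bernoulli (neg_exp p 0 4) =
    harmonic_sum p 4 + P ^+ 1 * quotient_sum p 4 + P ^+ 2 * y.
  apply: congqE; apply: congq_trans (power_sum_congq p_gt2 (le4 0%N)).
  by apply: congq_sym; apply: power_sum_bernoulli2 => //; lia.
have [z hz Dz] := congqE (harmonic_sum_quotient p_gt2 (cop 4%N isT)).
apply: (@congq_intro _ _ _ _ ((y + z) / 5 - x)); first by p_int.
have -> : bernoulli (neg_exp p 0 4) = 5 * quotient_sum p 4 + P * (y + z).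
  by apply: (mulfI nzP); rewrite Dy Dz; ring.
by rewrite Dx; field.
Qed.

(** Modulo p^2 the exponent is -2, and (-2)(-3)/2 = 3. *)
Lemma binomial_neg_exp2 e :
    (3 < p)%N -> (2 <= e)%N -> 'C(neg_exp p e 2, 2)%:R / 3 =[p^ 2] 1.
Proof.
move=> p_gt3 e_ge2; set N := (p ^ e * p.-1)%N.
have N_ge3 : (3 <= N)%N by apply: leq_trans (leq_phi e); lia.
have D2 : 'C(N - 2, 2)%:R * 2 = (N%:R - 2) * (N%:R - 3) :> rat.
  have := bin_ffact (N - 2) 2; rewrite ffactnS ffactn1 -subn1 -subnDA.
  move/(congr1 (fun n => n%:R : rat)); rewrite (natrM _ 'C(_, _)) (natrM _ (N - 2)) => ->.
  by rewrite !natrB // ltnW.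
have i2 : (2%:R : rat)^-1 \in p_integral p by rewrite p_integral_natV //; lia.
have i3 : (3%:R : rat)^-1 \in p_integral p by rewrite p_integral_natV //; lia.
apply: (@congq_intro _ _ _ _ (P ^+ (e - 2) * p.-1%:R * (N%:R - 5) * 3^-1 * 2^-1)).
  by p_int.
have DN : N%:R = P ^+ 2 * P ^+ (e - 2) * p.-1%:R :> rat.
  by rewrite /N natrM natrX -exprD subnKC.
apply: (@mulIf _ 2) => //; rewrite mulrAC D2 DN.
by field.
Qed.

(** As H_2 = 2 p Q_2 modulo p^2, the hypothesis makes Q_2 divisible by p: this
    gains the one power of p that the exponent p^3 (p-1) - 2 lacks for a
    congruence modulo p^5. *)
Lemma harmonic_sum2_bernoulli :
    (7 < p)%N -> harmonic_sum p 2 =[p^ 2] 0 ->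
  harmonic_sum p 2 =[p^ 5]
    P * bernoulli (neg_exp p 3 2) + P ^+ 2 * harmonic_sum p 4.
Proof.
move=> p_gt7 H2_0; have p_gt2 : (2 < p)%N by lia.
have [lt2 lt4 lt6] : [/\ 2 < p.-1, 4 < p.-1 & 6 < p.-1]%N by split; lia.
have gt2 : (2 < neg_exp p 3 4)%N by apply: leq_trans (neg_exp_ge _ _); lia.
have gt4 : (4 < neg_exp p 3 2)%N by apply: leq_trans (neg_exp_ge _ _); lia.
have even2 : ~~ odd (neg_exp p 3 2) by rewrite odd_neg_exp.
have even4 : ~~ odd (neg_exp p 3 4) by rewrite odd_neg_exp.
have le_phi k : (k < p.-1)%N -> (k <= p ^ 3 * p.-1)%N.
  by move=> lt_k; apply: leq_trans (ltnW lt_k) (leq_phi 3).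
have cop k := @coprime_mersenne k p_gt7.
have B4 : bernoulli (neg_exp p 3 4) \in p_integral p by rewrite bernoulli_neg_integral // cop.
have B6 : bernoulli (neg_exp p 3 6) \in p_integral p by rewrite bernoulli_neg_integral // cop.
have Q2_0 : P ^+ 4 * quotient_sum p 2 =[p^ 5] 0.
  have Q2 : 2%:R * quotient_sum p 2 =[p^ 1] 2%:R * 0.
    rewrite mulr0 -(congq_shift 1 1) mulr0.
    apply: congq_trans H2_0; apply: congq_sym.
    apply: congq_trans (harmonic_sum_quotient p_gt2 (cop 2%N isT)) _.
    by rewrite mulrA [P ^+ 1 * _]mulrC congq_refl.
  rewrite -[X in congq _ _ _ X](mulr0 (P ^+ 4)) (congq_shift 4 1).
  by apply: congq_cancel Q2; rewrite // p_integral_natV //; lia.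
(* Q_4 enters with a factor p^4 only, so S_m is H_4 for m = p^3 (p-1) - 4. *)
have PB4 : P * bernoulli (neg_exp p 3 4) =[p^ 3] harmonic_sum p 4.
  apply: (@congq_trans _ _ (power_sum p (neg_exp p 3 4))).
    apply: congq_sym; apply: power_sum_bernoulli3 => //; first lia.
    by rewrite neg_exp_sub.
  apply: congq_trans (congq_leq _ (power_sum_congq p_gt2 (le_phi _ lt4))) _ => //.
  apply: (@congq_intro _ _ _ _ (P * quotient_sum p 4)); last by ring.
  by have hQ := quotient_sum_integral 4; p_int.
apply: (@congq_trans _ _ (power_sum p (neg_exp p 3 2))).
  rewrite -[X in congq _ _ X _]addr0; apply: congq_sym.
  apply: congq_trans (power_sum_congq p_gt2 (le_phi _ lt2)) _.
  by apply: congqD Q2_0; apply: congq_refl.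
apply: congq_trans (power_sum_bernoulli5 _ _ _ _) _ => //; first lia.
  by rewrite neg_exp_sub.
rewrite neg_exp_sub; apply: congqD (congq_refl _ _ _) _.
apply: (@congq_trans _ _ (P ^+ 3 * bernoulli (neg_exp p 3 4))).
  rewrite (congq_shift 3 2) -[X in congq _ _ _ X]mul1r.
  rewrite ![_ * bernoulli _]mulrC; apply: congqMl => //.
  by apply: binomial_neg_exp2; lia.
by rewrite (exprSr _ 2) -mulrA (congq_shift 2 3).
Qed.

(** The coefficient of p^4 H_4 is -1 from p^2 H_2 and -1/2 from the expansion of
    the binomial, -3/2 in all; 3/10 is that times the -1/5 of H_4. *)
Lemma wolstenholme_binomial_congq :
    (7 < p)%N -> ('C(2 * p - 1, p - 1)%:R : rat) =[p^ 4] 1 ->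
  ('C(2 * p - 1, p - 1)%:R : rat) =[p^ 7]
    1 - P ^+ 3 * bernoulli (neg_exp p 3 2)
      - 3 / 2 * P ^+ 5 * bernoulli (neg_exp p 1 4)
      + 3 / 10 * P ^+ 6 * bernoulli (neg_exp p 0 4).
Proof.
move=> p_gt7 C1; have [H2_0 C7] := binomial_harmonic_congq p_gt7 C1.
apply: congq_trans C7 _.
have [z2 hz2 ->] := congqE (harmonic_sum2_bernoulli p_gt7 H2_0).
have [z4 hz4 ->] := congqE (harmonic_sum4_bernoulli p_gt7).
have i2 : (2%:R : rat)^-1 \in p_integral p by rewrite p_integral_natV //; lia.
apply: (@congq_intro _ _ _ _ (- z2 - 3 * z4 * 2^-1)); first by p_int.
by field.
Qed.

End Congruences.

Theorem corollary2 (p : nat) (hp : wolstenholme_prime p) :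
  eqmodq p 7
    ('C(2 * p - 1, p - 1))%:R
    (1 - p%:R ^+ 3 * bernoulli (p ^ 4 - p ^ 3 - 2)%N
       - 3 / 2 * p%:R ^+ 5 * bernoulli (p ^ 2 - p - 4)%N
       + 3 / 10 * p%:R ^+ 6 * bernoulli (p - 5)%N).
Proof.
case: hp => p_pr hC.
have p_gt7 : (7 < p)%N.
  have [|p_le7] := ltnP 7 p => //; exfalso; move: hC p_pr.
  (* For p = 2, 3, 5, 7 the binomial is 3, 10, 126, 1716. *)
  by case: p p_le7 => [|[|[|[|[|[|[|[|n]]]]]]]].
have C1 : congq p 4 'C(2 * p - 1, p - 1)%:R 1.
  move/eqP: hC; rewrite eqn_mod_dvd ?bin_gt0; last lia.
  case/dvdnP=> c Dc; apply: (@congq_intro _ _ _ _ c%:R); first exact: rpred_nat.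
  by rewrite -natrX mulrC -natrM -Dc -(natrD _ 1) subnKC // bin_gt0; lia.
have -> : (p ^ 4 - p ^ 3 - 2 = neg_exp p 3 2)%N.
  by rewrite /neg_exp -subn1 mulnBr muln1 -expnSr.
have -> : (p ^ 2 - p - 4 = neg_exp p 1 4)%N.
  by rewrite /neg_exp -subn1 mulnBr muln1 -expnSr.
have -> : (p - 5 = neg_exp p 0 4)%N by rewrite /neg_exp mul1n -subn1 -subnDA.
exact: eqmodqP p_pr _ _ _ (wolstenholme_binomial_congq p_pr p_gt7 C1).
Qed.
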